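(* Let $G$ be a comb (with at least one vertex) and let $D$ be an orientation of $G$. Then $D$ has a vertex $v$ with $d^{+}_D(v)\le d^{++}_D(v)$.
   Context: Graphs are finite and simple. An orientation of $G$ is the digraph obtained by replacing each edge of $G$ by exactly one of its two possible arcs. For a vertex $v$ of $D$, $N^{+}_D(v)$ is the set of out-neighbors of $v$ and $d^{+}_D(v)=|N^{+}_D(v)|$. $N^{++}_D(v)$ is the set of vertices at distance exactly 2 from $v$ (out-neighbors of out-neighbors of $v$, excluding $N^{+}_D(v)$); $d^{++}_D(v)=|N^{++}_D(v)|$. A chair is a graph on 5 distinct vertices $x,y,z,t,v$ whose edges are exactly $xy,yz,zt,zv$; the co-chair is its complement. $C_n$ is the cycle on $n$ vertices and $\overline{H}$ is the complement of $H$. A comb is a graph having no induced subgraph isomorphic to $C_4$, $\overline{C_4}$, $C_5$, chair or co-chair. *)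

(* Defs.v *)
(* A graph on a finite type T is a relation e : rel T that is
   symmetric and irreflexive; a digraph is an arbitrary relation. *)
From mathcomp Require Import all_boot.

Set Implicit Arguments.
Unset Strict Implicit.
Unset Printing Implicit Defensive.

Definition simple_graph (T : finType) (e : rel T) : Prop :=
  symmetric e /\ irreflexive e.

Definition compl_graph (T : finType) (e : rel T) : rel T :=
  [rel x y | (x != y) && ~~ e x y].

(* The usual C_n, and a simple graph, only for 3 <= n. *)
Definition cycle_graph (n : nat) : rel 'I_n :=
  [rel i j | (ordS i == j) || (ordS j == i)].

(* The vertices x, y, z, t, v of the chair are 0, 1, 2, 3, 4. *)
Definition chair_edges : seq (nat * nat) :=
  [:: (0, 1); (1, 2); (2, 3); (2, 4)].

Definition chair : rel 'I_5 :=
  [rel i j : 'I_5 | ((val i, val j) \in chair_edges)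
                 || ((val j, val i) \in chair_edges)].

Definition cochair : rel 'I_5 := compl_graph chair.

(* Some induced subgraph of (T, e) is isomorphic to (S, h): f is an isomorphism
   from (S, h) onto the subgraph of (T, e) induced by the image of f. *)
Definition has_induced (S : finType) (h : rel S) (T : finType) (e : rel T)
    : Prop :=
  exists2 f : S -> T, injective f & forall i j, e (f i) (f j) = h i j.

Definition comb (T : finType) (e : rel T) : Prop :=
  [/\ ~ has_induced (@cycle_graph 4) e,
      ~ has_induced (compl_graph (@cycle_graph 4)) e,
      ~ has_induced (@cycle_graph 5) e,
      ~ has_induced chair e
    & ~ has_induced cochair e].

Definition orientation (T : finType) (e D : rel T) : Prop :=
  (forall x y, e x y = D x y || D y x) /\
  (forall x y, ~~ (D x y && D y x)).

Definition out_nbrs (T : finType) (D : rel T) (v : T) : {set T} :=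
  [set w | D v w].

Definition second_out_nbrs (T : finType) (D : rel T) (v : T) : {set T} :=
  [set w | [&& w != v, w \notin out_nbrs D v
             & [exists u in out_nbrs D v, w \in out_nbrs D u]]].

(* Main.v *)
(* A comb is a split graph, with a clique K and an independent set S, and on an
   induced path u - a - v - b (necessarily with u, b in S and a, v in K) every
   other vertex of K sees both or none of u, b and every other vertex of S sees
   both or none of a, v. Call a non-adjacent pair (x, y) convenient if every
   in-neighbour of x reaches y within two steps. If every non-adjacent pair is
   convenient in some direction, the last vertex of a median order of D enlarged
   by the convenient pairs has the required property. A pair {a, b} fails only
   because of a directed induced path u -> a -> v -> b with b not reached from u,
   nor a from v, in two steps; then {a, b} is said to depend on {u, v}. Adding to
   D a convenient arc between u and v removes this obstruction, gives its tail
   one more out-neighbour and at most one more second out-neighbour, and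
   affects no other vertex, so the property passes from the enlarged digraph
   back to D.
   As long as some pair depends on a pair that itself depends on a third one,
   the first pair of such a chain can be filled and the underlying graph stays a
   comb. Once there are no chains, filling all pairs that are convenient from K
   to S, and then those convenient from S to K, leaves no dependency. *)
Require Import Defs.
From mathcomp Require Import all_boot zify.
Set Implicit Arguments.
Unset Strict Implicit.
Unset Printing Implicit Defensive.

Lemma sub_in_count (T : eqType) (a b : pred T) (s : seq T) :
  {in s, forall x, a x -> b x} -> count a s <= count b s.
Proof.
move=> ab; rewrite (@eq_in_count _ a (predI a b) s).
  by apply: sub_count => x /andP[].
by move=> x xs /=; case ax: (a x) => //=; rewrite ab.
Qed.

(** * Median orders of a digraph and their exchange property *)

Section MedianOrder.
Variables (T : finType) (R : rel T).

Fixpoint forward_arcs (s : seq T) : nat :=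
  if s is x :: s' then count (R x) s' + forward_arcs s' else 0.

Lemma forward_arcs_cat (p s t : seq T) :
  perm_eq s t -> forward_arcs s < forward_arcs t ->
  forward_arcs (p ++ s) < forward_arcs (p ++ t).
Proof.
move=> st lt_st; elim: p => //= y p IHp.
by rewrite (permP (perm_cat (perm_refl p) st)) ltn_add2l.
Qed.

Lemma forward_arcs_move (m q : seq T) (x : T) :
  forward_arcs (m ++ x :: q) + count (R x) m =
  forward_arcs (x :: m ++ q) + count (R^~ x) m.
Proof.
elim: m => [|y m IHm] //=; move: IHm => /=; rewrite !count_cat /=; lia.
Qed.

(** An order with the most forward arcs works: moving [x] in front of the block [m] exchanges the
    arcs from [m] to [x] for those from [x] to [m], which cannot raise the count. *)
Lemma median_order :
  exists s : seq T, [/\ uniq s, s =i T &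
    forall p m x q, s = p ++ m ++ x :: q ->
      count (R x) m <= count (R^~ x) m].
Proof.
pose w := fun t : #|T|.-tuple T => forward_arcs t.
have uT : uniq (enum_tuple T) by apply: enum_uniq.
case: (@arg_maxnP _ (enum_tuple T) (fun t : #|T|.-tuple T => uniq t) w uT)
  => t ut max_t.
exists t; split=> //.
  have ct : #|t| = #|T| by rewrite (card_uniqP ut) size_tuple.
  by apply/(subset_cardP ct); apply/subset_predT.
move=> p m x q def_t; rewrite leqNgt; apply/negP=> ltm.
have pe : perm_eq (m ++ x :: q) (x :: m ++ q).
  by rewrite -cat_rcons -cats1 -catA perm_catCA.
have pet : perm_eq t (p ++ x :: m ++ q) by rewrite def_t perm_cat2l.
have sz : size (p ++ x :: m ++ q) == #|T|.
  by rewrite -(perm_size pet) size_tuple.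
have := max_t (Tuple sz); rewrite -(perm_uniq pet) => /(_ ut).
rewrite /w /= leqNgt def_t forward_arcs_cat //.
by have := forward_arcs_move m q x; lia.
Qed.

End MedianOrder.

(** * Convenient pairs and the second neighbourhood property *)

Section Digraph.
Variable T : finType.
Implicit Types (D X : rel T) (K : {set T}).

Definition adj D : rel T := [rel x y | D x y || D y x].

Definition two_step D : rel T := [rel x y | [exists z, D x z && D z y]].

Definition within_two D : rel T := [rel x y | D x y || two_step D x y].

Definition convenient D : rel T :=
  [rel x y | [forall z, D z x ==> within_two D z y]].

Definition has_SNP D (v : T) : bool :=
  #|out_nbrs D v| <= #|second_out_nbrs D v|.

Definition asymmetric D : Prop := forall x y, D x y -> ~~ D y x.

Lemma two_stepI D z x y : D x z -> D z y -> two_step D x y.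
Proof. by move=> xz zy; apply/existsP; exists z; rewrite xz. Qed.

Lemma two_stepP D x y :
  reflect (exists2 z, D x z & D z y) (two_step D x y).
Proof.
by apply: (iffP existsP) => [[z /andP[]]|[z xz zy]]; exists z; rewrite ?xz.
Qed.

Lemma within_twoP D x y :
  reflect (D x y \/ exists2 z, D x z & D z y) (within_two D x y).
Proof.
apply: (iffP orP) => [[xy|/two_stepP xy]|[xy|/two_stepP xy]];
  by [left|right].
Qed.

Lemma convenientP D x y :
  reflect (forall z, D z x -> within_two D z y) (convenient D x y).
Proof.
by apply: (iffP forallP) => xy z; [move/(_ z)/implyP: xy|apply/implyP/xy].
Qed.

Lemma convenientPn D x y :
  reflect (exists2 z, D z x & ~~ within_two D z y) (~~ convenient D x y).
Proof.
by rewrite negb_forall; apply: (iffP existsP) => [[z]|[z zx zy]];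
  [rewrite negb_imply => /andP[]|]; exists z => //; rewrite negb_imply zx.
Qed.

Lemma in_second D v w :
  (w \in second_out_nbrs D v) = [&& w != v, ~~ D v w & two_step D v w].
Proof.
by rewrite !inE; congr [&& _, _ & _]; apply: eq_existsb => u; rewrite !inE.
Qed.

Lemma adjC D x y : adj D x y = adj D y x.
Proof. exact: orbC. Qed.

Lemma adjPn D x y : reflect (~~ D x y /\ ~~ D y x) (~~ adj D x y).
Proof. by rewrite negb_or; apply: andP. Qed.

(* The convenient arcs are added to D before taking a median order; an arc
   y -> x that was added does not create a false second out-neighbour x of the
   last vertex f, because f dominates y in D and the arc is convenient. *)
Lemma convenient_SNP D (x0 : T) :
    asymmetric D ->
    (forall x y, x != y -> ~~ adj D x y ->
       convenient D x y || convenient D y x) ->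
  exists v, has_SNP D v.
Proof.
move=> asymD good.
(* Arcs of [D] take precedence; a non-adjacent pair convenient in both directions receives both
   arcs. *)
pose R := [rel x y | ~~ D y x && (D x y || convenient D x y)].
have [s [us sT med]] := median_order R.
case/lastP: s => [|s f] in us sT med *; first by have := sT x0.
exists f; rewrite /has_SNP.
move: us; rewrite rcons_uniq => /andP[fs us].
set N := out_nbrs D f; set G := second_out_nbrs D f.
have countE (A : {set T}) : f \notin A -> #|A| = count (mem A) s.
  move=> fA; rewrite -size_filter -(card_uniqP _) ?filter_uniq //.
  apply: eq_card => x; rewrite mem_filter [RHS]/=.
  case xA: (x \in A) => //=; have := sT x; rewrite mem_rcons inE.
  by case: eqP => // xf _; rewrite -xf xA in fA.
have irr x : ~~ D x x by apply/negP => xx; have := asymD _ _ xx; rewrite xx.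
rewrite !countE ?in_second ?eqxx // ?inE ?irr //.
(* The claim is made for every suffix of the order, so that induction can cut [q] at its first bad
   vertex. *)
suff: forall p q, s = p ++ q -> count (mem N) q <= count (mem G) q.
  by move=> /(_ [::] s); apply.
move=> p q; move: {2}(size q) (leqnn (size q)) => n; elim: n p q => [|n IHn] p q.
  by case: q.
move=> szq def_s.
pose bad x := (x \notin N) && (x \notin G).
have [/hasP[x0' x0q bx0]|nobad] := boolP (has bad q); last first.
  apply: leq_trans (_ : count (R f) q <= _).
    apply: sub_count => y; rewrite /= inE => fy; rewrite fy andbT.
    exact: asymD.
  apply: leq_trans (med p q f [::] _) _.
    by rewrite -cats1 def_s -catA.
  apply: sub_in_count => y yq /= /andP[nfy _].
  apply/negPn/negP => nG; move/hasPn: nobad => /(_ y yq).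
  by rewrite /bad nG inE nfy.
have hb : has bad q by apply/hasP; exists x0'.
case: (split_find hb) szq def_s => x q1 q2 bx nb1 szq def_s.
move: bx; rewrite /bad => /andP[xN xG].
have xf : x != f.
  apply: contraNneq fs => <-; rewrite def_s mem_cat mem_cat mem_rcons inE eqxx.
  by rewrite orbT.
have nw : ~~ within_two D f x.
  move: xN xG; rewrite in_second inE xf => nfx /=; rewrite nfx /= => n2.
  by rewrite /within_two /= negb_or nfx n2.
have NR y : y \in N -> ~~ R y x.
  rewrite inE => fy; apply/negP => /andP[nxy /orP[yx|/convenientP/(_ f fy)]].
    by case/negP: nw; apply/orP; right; exact: two_stepI yx.
  exact/negP.
have RN y : y \in N -> R x y.
  move=> yN; have nyx := NR _ yN.
  have xy : x != y by apply: contraNneq xN => ->.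
  move: nyx; rewrite /=.
  have [yx|nyx] := boolP (D y x); first by rewrite (negPf (asymD _ _ yx)).
  have [//|nxy /=] := boolP (D x y).
  have := good _ _ xy; rewrite /adj /= (negPf nyx) (negPf nxy) => /(_ isT).
  by case: (convenient D x y) => //= ->.
rewrite -cats1 -catA /= in def_s szq *.
rewrite !count_cat /= (negPf xN) /=.
apply: leq_add; last first.
  rewrite add0n; apply: leq_trans (leq_addl _ _).
  apply: (IHn (p ++ rcons q1 x)); first by move: szq; rewrite size_cat /=; lia.
  by rewrite def_s -cats1 -!catA.
(* Before the first bad vertex [x], the out-neighbours of [f] are all dominated by [x] in [R]; the
   median property at [x] bounds them by the vertices of [q1] dominating [x], which are not in [N]
   by [NR] and, not being bad, lie in [G]. *)
apply: leq_trans (_ : count (R x) q1 <= _).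
  by apply: sub_count => y; apply: RN.
apply: leq_trans (med p q1 x (q2 ++ [:: f]) _) _.
  by rewrite -cats1 def_s -!catA.
apply: sub_in_count => y yq1 Ryx; change (y \in G).
apply/negPn/negP => yG; move/hasPn: nb1 => /(_ y yq1); rewrite /bad yG andbT negbK.
by move=> /NR/negP; apply.
Qed.

(** * Adding arcs and carrying the property back *)

Definition add_arcs D X : rel T := [rel x y | D x y || X x y].

(** Each new out-neighbour [x] of [f] accounts for at most one new second out-neighbour, [g f x], so
    deleting the arcs [X] lowers the out-degree at least as much as the second out-degree. *)
Lemma add_arcs_SNP D X (g : T -> T -> T) f :
    (forall x y, X x y -> ~~ D x y) ->
    (forall w, w != f -> ~~ within_two D f w -> two_step (add_arcs D X) f w ->
       exists2 x, X f x & w = g f x) ->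
  has_SNP (add_arcs D X) f -> has_SNP D f.
Proof.
move=> disjX newX; rewrite /has_SNP.
pose Xf := [set x | X f x].
have -> : out_nbrs (add_arcs D X) f = out_nbrs D f :|: Xf.
  by apply/setP=> x; rewrite !inE.
rewrite cardsU (_ : _ :&: _ = set0) ?cards0 ?subn0; last first.
  apply/setP=> x; rewrite !inE; apply/negP => /andP[fx /disjX].
  by rewrite fx.
suff /subset_leq_card : second_out_nbrs (add_arcs D X) f
    \subset second_out_nbrs D f :|: [set g f x | x in Xf].
  move=> sub le; rewrite -(leq_add2r #|Xf|); apply: leq_trans le _.
  apply: leq_trans sub _; apply: leq_trans (leq_card_setU _ _) _.
  by rewrite leq_add2l leq_imset_card.
apply/subsetP => w; rewrite in_setU !in_second.
move=> /and3P[wf nw tw]; have [nfw _] := norP nw; rewrite wf nfw.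
have [//|n2] := boolP (two_step D f w).
have [|x fx ->] := newX w wf _ tw; first by rewrite /= negb_or nfw.
by apply/imsetP; exists x; rewrite ?inE.
Qed.

(* A missing pair {a, b} is convenient in neither direction exactly when
   u -> a and v -> b for some non-adjacent u, v that do not reach b, resp. a,
   within two steps; when D has no induced C4 and no induced 2K2, the arc
   a -> v (say) is then present and u, a, v, b induce a path. *)
Record dependency D (u a v b : T) : Prop := Dependency {
  dep_ua : D u a;
  dep_av : D a v;
  dep_vb : D v b;
  dep_uv : ~~ adj D u v;
  dep_ab : ~~ adj D a b;
  dep_ub : ~~ two_step D u b;
  dep_va : ~~ two_step D v a }.

Definition dep D (u a v b : T) : bool :=
  [&& D u a && D a v, D v b, ~~ adj D u v && ~~ adj D a b, ~~ two_step D u b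
    & ~~ two_step D v a].

Lemma depP D u a v b : reflect (dependency D u a v b) (dep D u a v b).
Proof.
apply: (iffP and5P) => [[/andP[ua av] vb /andP[uv ab] ub va]|[ua av vb uv ab ub va]].
  by split.
by rewrite ua av uv ab.
Qed.

Definition source D (u v : T) : bool :=
  [exists a, exists b, dep D u a v b].

Lemma sourceP D u v :
  reflect (exists a b, dependency D u a v b) (source D u v).
Proof.
apply: (iffP existsP) => [[a /existsP[b /depP uv]]|[a [b /depP uv]]].
  by exists a, b.
by exists a; apply/existsP; exists b.
Qed.

Definition split_digraph K D : Prop :=
  [/\ asymmetric D,
      forall x y, x \in K -> y \in K -> x != y -> adj D x y
    & forall x y, x \notin K -> y \notin K -> ~~ adj D x y].

(** If [a] were outside [K], its neighbours [u] and [v] would both lie in [K] and be adjacent. *)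
Lemma dep_split K D u a v b : split_digraph K D -> dependency D u a v b ->
  [/\ u \notin K, a \in K, v \in K & b \notin K].
Proof.
move=> [asymD cK sK] [ua av vb uv ab ub va].
have uv' : u != v by apply: contraTneq ua => ->; exact: asymD.
have ab' : a != b by apply: contraTneq vb => <-; exact: asymD.
have A x y : D x y -> adj D x y by move=> xy; rewrite /adj /= xy.
have aK : a \in K.
  apply/negPn/negP => aK.
  have uK : u \in K by apply: contraTT (A _ _ ua) => uK; exact: sK.
  have vK : v \in K by apply: contraTT (A _ _ av) => vK; exact: sK.
  by rewrite cK in uv.
have bK : b \notin K by apply: contra ab => bK; exact: cK.
have vK : v \in K by apply: contraTT (A _ _ vb) => vK; exact: sK.
by split=> //; apply: contra uv => uK; exact: cK.
Qed.

Definition picked_dep D u v : T * T :=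
  odflt (u, u) [pick p : T * T | dep D u p.1 v p.2].

Lemma picked_depP D u v : source D u v ->
  dependency D u (picked_dep D u v).1 v (picked_dep D u v).2.
Proof.
move=> /sourceP[a [b /depP uv]]; rewrite /picked_dep.
by case: pickP => [p /depP //|/(_ (a, b))]; rewrite /= uv.
Qed.

(** A vertex [w] newly reached through an added arc [u -> v] could replace [b] in the dependency, so
    it is the unique end [b]. A new path that uses an old arc first is excluded by convenience. *)
Lemma add_end_to_middle K D X f :
    split_digraph K D ->
    (forall u a v b b',
       dependency D u a v b -> dependency D u a v b' -> b = b') ->
    (forall u v, X u v -> source D u v && convenient D u v) ->
  has_SNP (add_arcs D X) f -> has_SNP D f.
Proof.
move=> sD uniq_b Xsc.
apply: (@add_arcs_SNP _ _ (fun u v => (picked_dep D u v).2)) => [u v /Xsc|w wf].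
  by case/andP=> /sourceP[a [b [_ _ _ /adjPn[]]]].
rewrite /within_two /= negb_or => /andP[nfw n2].
move=> /two_stepP[x /orP[fx|fx] /orP[xw|xw]].
- by case/negP: n2; exact: two_stepI fx xw.
- have /andP[_ /convenientP/(_ f fx)] := Xsc _ _ xw.
  by rewrite /within_two /= (negPf nfw) (negPf n2).
- exists x => //; have /andP[/picked_depP] := Xsc _ _ fx.
  set a := _.1; set b := _.2 => d _.
  suff dw : dependency D f a x w by exact: uniq_b dw d.
  case: d => ua av vb uv ab ub va; split=> //.
  apply/adjPn; split; apply/negP => aw.
    by case/negP: n2; exact: two_stepI ua aw.
  by case/negP: va; exact: two_stepI xw aw.
- have /andP[/sourceP[a [b d]] _] := Xsc _ _ fx.
  have /andP[/sourceP[a' [b' d']] _] := Xsc _ _ xw.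
  case: (dep_split sD d) => _ _ xK _; case: (dep_split sD d') => /negP[].
  by rewrite xK.
Qed.

(** Dual case: a vertex [w] newly reached through an added arc [v -> u] lies in [K] and dominates
    [v], hence could replace [a] in the dependency. *)
Lemma add_middle_to_end K D X f :
    split_digraph K D ->
    (forall u a a' v b,
       dependency D u a v b -> dependency D u a' v b -> a = a') ->
    (forall v u, X v u -> source D u v && convenient D v u) ->
  has_SNP (add_arcs D X) f -> has_SNP D f.
Proof.
move=> sD uniq_a Xsc.
apply: (@add_arcs_SNP _ _ (fun v u => (picked_dep D u v).1)) => [v u /Xsc|w wf].
  by case/andP=> /sourceP[a [b [_ _ _ /adjPn[]]]].
rewrite /within_two /= negb_or => /andP[nfw n2].
move=> /two_stepP[x /orP[fx|fx] /orP[xw|xw]].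
- by case/negP: n2; exact: two_stepI fx xw.
- have /andP[_ /convenientP/(_ f fx)] := Xsc _ _ xw.
  by rewrite /within_two /= (negPf nfw) (negPf n2).
- exists x => //; have /andP[/picked_depP] := Xsc _ _ fx.
  set a := _.1; set b := _.2 => d _.
  have [xK aK fK bK] := dep_split sD d; case: (sD) => asymD cK sK.
  suff dw : dependency D x w f b by exact: uniq_a dw d.
  case: d => ua av vb uv ab ub va.
  have wK : w \in K.
    by apply/negPn/negP => wK; have := sK _ _ xK wK; rewrite /adj /= xw.
  have wf' : D w f by have := cK _ _ wK fK wf; rewrite /adj /= (negPf nfw) orbF.
  split=> //; apply/adjPn; split; apply/negP => wb.
    by case/negP: ub; exact: two_stepI xw wb.
  by case/negP: n2; exact: two_stepI vb wb.
- have /andP[/sourceP[a [b d]] _] := Xsc _ _ fx.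
  have /andP[/sourceP[a' [b' d']] _] := Xsc _ _ xw.
  case: (dep_split sD d) => /negP[].
  by case: (dep_split sD d').
Qed.

(** With [A] a clique and [B] independent, a violation is a chair: the path [t], [k'], [k] with
    leaves [t1], [t2] at [k]. *)
Definition no_chair (A B : pred T) (e : rel T) : Prop :=
  forall k k' t1 t2 t, A k -> A k' -> B t1 -> B t2 -> B t -> t1 != t2 ->
    e k t1 -> e k t2 -> ~~ e k' t1 -> ~~ e k' t2 -> e k' t -> e k t.

(* Complementation exchanges K with its complement and the chair with the
   co-chair, so that the second condition excludes co-chairs. *)
Definition comb_bipartition K (e : rel T) : Prop :=
  no_chair (fun x => x \in K) (fun x => x \notin K) e /\
  no_chair (fun x => x \notin K) (fun x => x \in K) e.

(** * Elementary facts on split digraphs and added arcs *)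

Lemma arc_adj D x y : D x y -> adj D x y.
Proof. by rewrite /adj /= => ->. Qed.

Lemma arc_adjr D x y : D x y -> adj D y x.
Proof. by rewrite /adj /= orbC => ->. Qed.

Lemma split_outside K D x y :
  split_digraph K D -> adj D x y -> x \notin K -> y \in K.
Proof. by case=> _ _ sK xy xK; apply: contraLR xy => yK; exact: sK. Qed.

Lemma split_inside K D x y :
  split_digraph K D -> ~~ adj D x y -> x != y -> x \in K -> y \notin K.
Proof. by case=> _ cK _ xy xNy xK; apply: contra xy => yK; exact: cK. Qed.

Lemma arc_neq D x y : asymmetric D -> D x y -> x != y.
Proof.
by move=> asymD xy; apply/eqP => e;
  have := asymD _ _ xy; rewrite -e in xy *; rewrite xy.
Qed.

Lemma add_arcs_sub D X x y : D x y -> add_arcs D X x y.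
Proof. by rewrite /add_arcs /= => ->. Qed.

Lemma add_arcs_adj D X x y : ~~ adj (add_arcs D X) x y -> ~~ adj D x y.
Proof. by move=> /adjPn[/norP[n1 _] /norP[n2 _]]; apply/adjPn. Qed.

Lemma add_arcs_two_step D X x y :
  ~~ two_step (add_arcs D X) x y -> ~~ two_step D x y.
Proof.
apply: contra => /two_stepP[z xz zy]; apply: (@two_stepI _ z);
  exact: add_arcs_sub.
Qed.

Lemma add_arcs_within_two D X x y :
  within_two D x y -> within_two (add_arcs D X) x y.
Proof.
move=> /within_twoP[xy|[z xz zy]]; apply/within_twoP.
  by left; apply: add_arcs_sub.
by right; exists z; apply: add_arcs_sub.
Qed.

Lemma split_add_arcs K D X :
    split_digraph K D ->
    (forall x y, X x y ->
       [/\ ~~ adj D x y, ~~ X y x & (x \in K) != (y \in K)]) ->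
  split_digraph K (add_arcs D X).
Proof.
move=> [asymD cK sK] XP; split.
- move=> x y /orP[xy|xy].
    rewrite /= negb_or asymD //=; apply/negP => /XP[/adjPn[_]].
    by rewrite xy.
  by have [/adjPn[_ nyx] nX _] := XP _ _ xy; rewrite /= negb_or nyx.
- move=> x y xK yK xy; have /orP[D1|D1] := cK _ _ xK yK xy;
    rewrite /adj /add_arcs /= D1 ?orbT //.
- move=> x y xK yK; have /adjPn[n1 n2] := sK _ _ xK yK.
  rewrite /adj /add_arcs /= (negPf n1) (negPf n2) /= negb_or.
  by apply/andP; split; apply/negP => /XP[_ _]; rewrite (negPf xK) (negPf yK).
Qed.

(** The in-neighbours [z] and [z'] witnessing the two failures cannot both lie in [K]: an arc
    between them would make one reach its target in two steps. The one outside [K] starts the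
    dependency. *)
Lemma inconvenient_dep K D x y :
    split_digraph K D -> x != y -> ~~ adj D x y ->
    ~~ convenient D x y -> ~~ convenient D y x ->
  (exists u v, dependency D u x v y) \/ (exists u v, dependency D u y v x).
Proof.
move=> sD; case: (sD) => asymD cK sK.
move=> xy nxy /convenientPn[z zx nzy] /convenientPn[z' zy' nzx'].
have main p q r r' : p != q -> ~~ adj D p q -> D r p -> ~~ within_two D r q ->
    D r' q -> ~~ within_two D r' p -> r \notin K -> dependency D r p r' q.
  move=> pq npq rp nrq rq' nrp' rK.
  have [nrq1 nrq2] := norP nrq; have [nrp1 nrp2] := norP nrp'.
  have pK := split_outside sD (arc_adj rp) rK.
  have qK := split_inside sD npq pq pK.
  have rK' := split_outside sD (arc_adjr rq') qK.
  have pr' : p != r' by apply: contraNneq npq => ->; exact: arc_adj.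
  split=> //.
  - by have := cK _ _ pK rK' pr'; rewrite /adj /= (negPf nrp1) orbF.
  - apply/adjPn; split.
      by apply: contra nrq2 => rr'; exact: two_stepI rr' rq'.
    by apply: contra nrp2 => rr'; exact: two_stepI rr' rp.
have [zK|zK] := boolP (z \in K); last by left; exists z, z'; apply: main.
have [zK'|zK'] := boolP (z' \in K); last first.
  by right; exists z', z; apply: main; rewrite // ?(eq_sym y) // adjC.
have zz' : z != z'.
  by apply: contraNneq nzy => ->; rewrite /within_two /= zy'.
have /orP[zz|zz] := cK _ _ zK zK' zz'.
  by case/negP: nzy; apply/orP; right; exact: two_stepI zz zy'.
by case/negP: nzx'; apply/orP; right; exact: two_stepI zz zx.
Qed.

Lemma independent_SNP K D (x0 : T) :
    split_digraph K D -> (forall u a v b, ~ dependency D u a v b) ->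
  exists v, has_SNP D v.
Proof.
move=> sD nodep; apply: (convenient_SNP x0); first by case: sD.
move=> x y xy nxy; apply/negPn/negP; rewrite negb_or => /andP[cxy cyx].
by case: (inconvenient_dep sD xy nxy cxy cyx) => [[u [v /nodep]]|[u [v /nodep]]].
Qed.

(** * Combs without chains of dependencies *)

Section CombOrientation.
Variables (K : {set T}) (D : rel T).
Hypotheses (sD : split_digraph K D) (cD : comb_bipartition K (adj D)).

(** A vertex of [K] seeing only one end would form a co-chair with the path [u], [a], [v], [b]. *)
Lemma dep_adj_ends u a v b k : dependency D u a v b ->
  k \in K -> k != a -> k != v -> adj D k u = adj D k b.
Proof.
move=> d kK ka kv; have [uK aK vK bK] := dep_split sD d.
case: d => ua av vb uv ab _ _; case: cD => _ cS.
apply/idP/idP => k1; apply/negPn/negP => k2.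
  have := cS u b a k v uK bK aK kK vK; rewrite eq_sym => /(_ ka).
  rewrite arc_adj // adjC k1 adjC ab adjC k2 arc_adjr // (negPf uv).
  by move/(_ isT isT isT isT isT).
have := cS b u v k a bK uK vK kK aK; rewrite eq_sym => /(_ kv).
rewrite arc_adjr // adjC k1 uv adjC k2 arc_adj // adjC (negPf ab).
by move/(_ isT isT isT isT isT).
Qed.

(** A vertex outside [K] seeing only one middle would form a chair with the path. *)
Lemma dep_adj_middles u a v b s : dependency D u a v b ->
  s \notin K -> s != u -> s != b -> adj D s a = adj D s v.
Proof.
move=> d sK su sb; have [uK aK vK bK] := dep_split sD d.
case: d => ua av vb uv ab _ _; case: cD => cC _.
apply/idP/idP => k1; apply/negPn/negP => k2.
  have := cC a v u s b aK vK uK sK bK; rewrite eq_sym => /(_ su).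
  rewrite arc_adjr // adjC k1 adjC uv adjC k2 arc_adj // (negPf ab).
  by move/(_ isT isT isT isT isT).
have := cC v a b s u vK aK bK sK uK; rewrite eq_sym => /(_ sb).
rewrite arc_adj // adjC k1 ab adjC k2 arc_adjr // adjC (negPf uv).
by move/(_ isT isT isT isT isT).
Qed.

(** A second middle [a'] would see [u] but not [b], against [dep_adj_ends]. *)
Lemma dep_uniq_middle u a a' v b :
  dependency D u a v b -> dependency D u a' v b -> a = a'.
Proof.
move=> d d'; apply/eqP; rewrite eq_sym; apply/negPn/negP => aa'.
have [_ aK' _ _] := dep_split sD d'.
have av' : a' != v.
  by apply: contraTneq (dep_uv d) => <-; rewrite negbK; apply/arc_adj/(dep_ua d').
have := dep_adj_ends d aK' aa' av'.
by rewrite (arc_adjr (dep_ua d')) (negPf (dep_ab d')).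
Qed.

Lemma dep_uniq_end u a v b b' :
  dependency D u a v b -> dependency D u a v b' -> b = b'.
Proof.
move=> d d'; apply/eqP; rewrite eq_sym; apply/negPn/negP => bb'.
have [_ _ _ bK'] := dep_split sD d'.
have bu' : b' != u.
  by apply: contraTneq (dep_uv d) => <-; rewrite negbK; apply/arc_adjr/(dep_vb d').
have := dep_adj_middles d bK' bu' bb'.
by rewrite (arc_adjr (dep_vb d')) adjC (negPf (dep_ab d')).
Qed.

Let X1 : rel T := [rel v u | source D u v && convenient D v u].
Let D1 := add_arcs D X1.

Lemma X1_spec v u : X1 v u -> [/\ ~~ adj D v u, v \in K & u \notin K].
Proof.
move=> /andP[/sourceP[a [b d]] _]; have [uK _ vK _] := dep_split sD d.
by rewrite adjC (dep_uv d).
Qed.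

Lemma split_D1 : split_digraph K D1.
Proof.
apply: split_add_arcs => // v u vu; have [nvu vK uK] := X1_spec vu.
split; rewrite ?vK ?(negPf uK) //; apply/negP => /X1_spec[_].
by rewrite (negPf uK).
Qed.

Lemma D1_outside u a : u \notin K -> D1 u a -> D u a.
Proof. by move=> uK /orP[//|/X1_spec[_]]; rewrite (negPf uK). Qed.

Lemma D1_inside u a : a \in K -> D1 u a -> D u a.
Proof. by move=> aK /orP[//|/X1_spec[_ _]]; rewrite aK. Qed.

Lemma dep_D1 u a v b : dependency D1 u a v b -> dependency D u a v b.
Proof.
move=> d1; have [uK aK vK bK] := dep_split split_D1 d1.
case: (d1) => ua av vb uv ab ub va.
have ua0 := D1_outside uK ua; have av0 := D1_inside vK av.
have uv0 := add_arcs_adj uv; have ab0 := add_arcs_adj ab.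
have ub0 := add_arcs_two_step ub; have va0 := add_arcs_two_step va.
case/orP: vb => [vb|]; first by split.
(* If [v -> b] is new, then [{b, v}] is a source with end [b0]. It follows that [u], [a], [v], [b0]
   is a dependency of [D] and that [v] is convenient towards [u], so [X1] already joins [v] to
   [u]. *)
move=> /andP[/sourceP[a0 [b0 d0]] /convenientP conv_vb].
have [_ aK0 _ bK0] := dep_split sD d0.
have [asymD cK sK] := sD.
have ends := dep_adj_ends d0.
have not_a0 w : ~~ adj D w b -> w != a0.
  by apply: contraNneq => ->; exact: arc_adjr (dep_ua d0).
have neq_v w : adj D w b -> w != v.
  by apply: contraTneq => ->; rewrite adjC; exact: dep_uv d0.
have to_b w : D u w -> ~~ D w b.
  by move=> uw; apply: contra ub0 => wb; exact: two_stepI uw wb.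
have uw_neq_v w : D u w -> w != v.
  by move=> uw; apply: contraNneq uv0 => <-; exact: arc_adj.
have ab1 : ~~ adj D a b0 by rewrite -ends ?not_a0 // uw_neq_v.
have d : dependency D u a v b0.
  split=> //; first exact: dep_vb d0.
  apply/negP => /two_stepP[w uw wb0].
  have wK := split_outside sD (arc_adj uw) uK.
  have wa0 : w != a0.
    by apply: contraTneq (arc_adj wb0) => ->; exact: dep_ab d0.
  have: adj D w b by rewrite ends ?(uw_neq_v w) // arc_adj.
  case/orP=> [|bw]; first by apply/negP/to_b.
  by case/negP: (dep_ub d0); exact: two_stepI bw wb0.
have ends' := dep_adj_ends d.
(* in-neighbours of b are adjacent to u, hence dominate u *)
have in_b w : D w b -> D w u.
  move=> wb; have wK := split_outside sD (arc_adjr wb) bK.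
  have wv := neq_v _ (arc_adj wb).
  have wa0 : w != a0 by apply: contraTneq wb => ->; exact: asymD _ _ (dep_ua d0).
  have wa : w != a by apply: contraTneq (arc_adj wb) => ->.
  have: adj D w u by rewrite ends' // -ends // arc_adj.
  by case/orP=> // /to_b; rewrite wb.
have Xvu : X1 v u.
  apply/andP; split; first by apply/sourceP; exists a, b0.
  apply/convenientP => y /conv_vb /within_twoP[yb|[w yw wb]]; apply/within_twoP.
    by left; exact: in_b.
  by right; exists w => //; exact: in_b.
by case/adjPn: uv => _ /norP[_]; rewrite Xvu.
Qed.

Hypothesis no_chain :
  forall u a v b y x, dependency D u a v b -> ~ dependency D y v x u.

(** Left unfilled by [X1], the pair is convenient from [u] to [v] in [D], since otherwise it would
    depend on a third pair and form a chain. What remains is the in-neighbours of [u] created by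
    [X1]. *)
Lemma convenient_D1 u v : source D1 u v -> convenient D1 u v.
Proof.
move=> /sourceP[a [b d1]]; have d := dep_D1 d1.
have [uK aK vK bK] := dep_split sD d; have [asymD cK sK] := sD.
have Xvu : ~~ X1 v u by case/adjPn: (dep_uv d1) => _ /norP[].
have nvu : ~~ convenient D v u.
  by apply: contra Xvu => cvu; apply/andP; split=> //; apply/sourceP; exists a, b.
have cuv : convenient D u v.
  apply/negPn/negP => nuv.
  have uNv : u != v by apply: contraNneq uK => ->.
  have [[y [x dx]]|[y [x dx]]] := inconvenient_dep sD uNv (dep_uv d) nuv nvu.
    by have [_] := dep_split sD dx; rewrite (negPf uK).
  exact: (no_chain d dx).
have [y yv nyu] := convenientPn _ _ _ nvu.
apply/convenientP => x /orP[xu|Xxu].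
  by apply: add_arcs_within_two; move/convenientP: cuv; apply.
have [_ xK _] := X1_spec Xxu.
case/andP: (Xxu) => /sourceP[a' [b' d']] /convenientP conv_xu.
have [_ _ _ bK'] := dep_split sD d'.
have xv : x != v by apply: contraNneq Xvu => <-.
have /orP[D_xv|D_vx] := cK _ _ xK vK xv.
  by apply: add_arcs_within_two; rewrite /within_two /= D_xv.
have nyx : ~~ D y x by apply: contra nyu; exact: conv_xu.
have [xy|nxy] := boolP (D x y).
  apply: add_arcs_within_two; apply/orP; right; exact: two_stepI xy yv.
have nadj_xy : ~~ adj D x y by apply/adjPn.
have x_y : x != y by apply: contraTneq D_vx => ->; exact: asymD.
have yK := split_inside sD nadj_xy x_y xK.
have vb' : ~~ adj D v b'.
  rewrite -(dep_adj_ends d') //; last by rewrite eq_sym.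
    by rewrite adjC; exact: dep_uv d.
  by apply: contraNneq (dep_uv d) => ->; exact: arc_adj (dep_ua d').
have xb : ~~ adj D x b.
  rewrite -(dep_adj_ends d) //.
    by rewrite adjC; exact: dep_uv d'.
  by apply: contraNneq (dep_uv d') => ->; exact: arc_adj (dep_ua d).
(* The path [b'], [x], [v] with leaves [b], [y] at [v] would be a chair. *)
case: cD => cC _; have := cC v x b y b' vK xK bK yK bK'.
have -> : b != y by apply: contraTneq (dep_vb d) => ->; exact: asymD.
rewrite (arc_adj (dep_vb d)) (arc_adjr yv) (negPf vb') xb nadj_xy.
by rewrite (arc_adj (dep_vb d')); move/(_ isT isT isT isT isT isT).
Qed.

Let X2 : rel T := source D1.
Let D2 := add_arcs D1 X2.

Lemma X2_spec u v : X2 u v -> [/\ ~~ adj D1 u v, u \notin K & v \in K].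
Proof.
move=> /sourceP[a [b d]]; have [uK _ vK _] := dep_split split_D1 d.
by rewrite (dep_uv d).
Qed.

Lemma split_D2 : split_digraph K D2.
Proof.
apply: split_add_arcs => [|u v uv]; first exact: split_D1.
have [nvu uK vK] := X2_spec uv.
split; rewrite ?vK ?(negPf uK) //; apply/negP => /X2_spec[_].
by rewrite vK.
Qed.

(** It suffices that [{u, v}] is a source of [D1], because [X2] then fills it. If [u -> a] came from
    [X2], the first middle [a0] of the dependency that created it takes the place of [a]. *)
Lemma independent_D2 u a v b : ~ dependency D2 u a v b.
Proof.
move=> d2; have [uK aK vK bK] := dep_split split_D2 d2.
case: (d2) => ua2 av2 vb2 uv2 ab2 ub2 va2.
have uv1 := add_arcs_adj uv2; have ab1 := add_arcs_adj ab2.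
have ub1 := add_arcs_two_step ub2; have va1 := add_arcs_two_step va2.
have D2_inside x y : x \in K -> D2 x y -> D1 x y.
  by move=> xK /orP[//|/X2_spec[_]]; rewrite xK.
have av := D2_inside _ _ aK av2; have vb := D2_inside _ _ vK vb2.
have sD1 := split_D1; have [asymD1 cK1 sK1] := sD1.
have [a0 d0] : exists a0, dependency D1 u a0 v b; last first.
  have Xuv : X2 u v by apply/sourceP; exists a0, b.
  by case/adjPn: uv2 => /norP[_]; rewrite Xuv.
case/orP: ua2 => [ua|/sourceP[a0 [b0 d1]]]; first by exists a.
have d0 := dep_D1 d1; have [_ aK0 _ _] := dep_split sD d0.
exists a0; case: (d1) => ua0 aa0 ab0 uNa a0b0 ub0 aa02.
have a0v : a0 != v by apply: contraNneq uv1 => <-; exact: arc_adj.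
have ub : u != b.
  by apply: contraNneq uv1 => ->; exact: arc_adjr.
have in_a0 w : D1 w a0 -> w \notin K -> ~~ adj D1 w a -> w = u.
  move=> wa0 wK nwa; apply/eqP/negPn/negP => wu.
  have wa00 := D1_outside wK wa0.
  have wb0 : w != b0.
    by apply: contraNneq (dep_ab d0) => <-; exact: arc_adjr.
  have := dep_adj_middles d0 wK wu wb0.
  by rewrite (arc_adj wa00) (negPf (add_arcs_adj nwa)).
split=> //.
- have := cK1 _ _ aK0 vK a0v; case/orP=> // va0.
  by case/negP: aa02; exact: two_stepI av va0.
- apply/adjPn; split; apply/negP => a0b.
    by case/negP: ub1; exact: two_stepI ua0 a0b.
  by case/eqP: ub; rewrite (in_a0 _ a0b) // adjC.
- apply/negP => /two_stepP[w vw wa0].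
  have [wa|nwa] := boolP (adj D1 w a).
    case/orP: wa => wa; first by case/negP: va1; exact: two_stepI vw wa.
    by case/negP: aa02; exact: two_stepI wa wa0.
  have wK : w \notin K.
    apply: contra nwa => wK; apply: cK1 => //.
    by apply: contraTneq vw => ->; exact: asymD1.
  by case/adjPn: uv1 => _ /negP[]; rewrite -(in_a0 _ wa0 wK nwa).
Qed.

(** The property goes from [D2] to [D1] and then to [D]; uniqueness of ends in [D1] is inherited
    from [D] through [dep_D1]. *)
Lemma unchained_SNP (x0 : T) : exists v, has_SNP D v.
Proof.
have [f sf] := independent_SNP x0 split_D2 independent_D2.
exists f; apply: (add_middle_to_end (X := X1) sD) => [u a a' v b|//|].
  exact: dep_uniq_middle.
apply: (add_end_to_middle split_D1 _ _ sf) => [u a v b b' d d'|u v uv].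
  exact: (dep_uniq_end (dep_D1 d) (dep_D1 d')).
by rewrite [source _ _ _]uv convenient_D1.
Qed.

End CombOrientation.

(** * Filling the first pair of a chain *)

Lemma no_chair_add (A B : pred T) (e e' : rel T) x y u v :
    A x -> A v -> B y -> B u -> u != y -> e v y -> e x u ->
    (forall k, A k -> k != x -> k != v -> e k y = e k u) ->
    (forall s, B s -> s != y -> s != u -> e x s = e v s) ->
    (forall k s, A k -> B s -> e k s -> ~~ e k y -> ~~ e x s -> False) ->
    (forall p q, A p -> B q -> e' p q = e p q || (p == x) && (q == y)) ->
  no_chair A B e -> no_chair A B e'.
Proof.
move=> Ax Av By Bu uy vy xu ends mids noleg e'E nc k k' t1 t2 t Ak Ak' B1 B2 Bt t12.
(* When the new edge joins [k = x] to the leaf [y], replacing [y] by [u] gives a violation in [e],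
   unless [u] is already the other leaf; that case is what [noleg] forbids. *)
have main r1 r2 : B r1 -> B r2 -> r1 != r2 -> k = x -> r1 = y -> e k r2 ->
    ~~ e k' r1 -> ~~ e k' r2 -> e k' t -> e k t.
  move=> Br1 Br2 r12 kx r1y; rewrite {}kx {r1}r1y in Br1 r12 *.
  move=> xr2 nky nkr2 kt.
  have kx : k' != x by apply: contraNneq nkr2 => ->.
  have kv : k' != v by apply: contraNneq nky => ->.
  have nku : ~~ e k' u by rewrite -ends.
  have [r2u|r2u] := eqVneq r2 u; last first.
    by apply: nc xr2 _ _ nku kt => //; rewrite eq_sym.
  apply/negPn/negP => nxt.
  have ty : t != y by apply: contraTneq kt => ->.
  have tu : t != u by apply: contraTneq kt => ->.
  exact: noleg _ _ Ak' Bt kt nky nxt.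
rewrite !e'E // !negb_or.
move=> k1 k2 /andP[nk1 _] /andP[nk2 _] kt; apply/orP.
case/orP: kt => [kt|/andP[/eqP k'x /eqP ty]].
  left; case/orP: k1 => [k1|/andP[/eqP kx /eqP ty]].
    case/orP: k2 => [k2|/andP[/eqP kx /eqP ty]].
      exact: nc k1 k2 nk1 nk2 kt.
    by apply: (main t2 t1); rewrite // eq_sym.
  case/orP: k2 => [k2|/andP[_ /eqP ty']]; first exact: (main t1 t2).
  by rewrite ty ty' eqxx in t12.
rewrite ty eqxx andbT; have [kx|kx] := eqVneq k x; [by right|left].
have [->//|kv] := eqVneq k v.
rewrite (negPf kx) !orbF in k1 k2; rewrite ends //.
by rewrite k'x in nk1 nk2; apply: (nc k x t1 t2).
Qed.

Definition inner_out D K x := [set w in K | D x w].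

(** An out-neighbour [w] of [v] in [K] must be dominated by [a], as [w -> a] would let [v] reach [a]
    in two steps; [v] itself makes the inclusion strict. *)
Lemma dep_inner_out K D u a v b : split_digraph K D -> dependency D u a v b ->
  #|inner_out D K v| < #|inner_out D K a|.
Proof.
move=> sD d; have [_ aK vK _] := dep_split sD d; have [asymD cK _] := sD.
apply/proper_card/properP; split; last first.
  exists v; rewrite !inE vK ?(dep_av d) //=.
  by apply/negP => vv; have := asymD _ _ vv; rewrite vv.
apply/subsetP => w; rewrite !inE => /andP[wK vw]; rewrite wK /=.
have aw : a != w.
  by apply: contraTneq vw => <-; exact: asymD _ _ (dep_av d).
have /orP[//|wa] := cK _ _ aK wK aw.
by case/negP: (dep_va d); exact: two_stepI vw wa.
Qed.

(** If [{y, x}] is convenient in neither direction, it depends on a further pair and the chain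
    shifts by one; [dep_inner_out] makes this stop. *)
Lemma first_chain K D u a v b y x : split_digraph K D ->
    dependency D u a v b -> dependency D y v x u ->
  exists u' a' v' b' y' x', [/\ dependency D u' a' v' b', dependency D y' v' x' u'
    & convenient D y' x' || convenient D x' y'].
Proof.
move=> sD; move: {2}#|_| (leqnn #|inner_out D K x|) => n.
elim: n u a v b y x => [|n IHn] u a v b y x len d1 d2.
  all: have [yK vK xK uK] := dep_split sD d2.
  all: have [good|] := boolP (convenient D y x || convenient D x y);
    first by exists u, a, v, b, y, x.
  all: rewrite negb_or => /andP[cyx cxy].
  all: have yx : y != x by apply: contraNneq yK => ->.
  all: have [[u' [v' d3]]|[u' [v' d3]]] :=
         inconvenient_dep sD yx (dep_uv d2) cyx cxy.
  1, 3: by have [_] := dep_split sD d3; rewrite (negPf yK).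
  all: have lt := dep_inner_out sD d3.
  by move: len lt; lia.
by apply: (IHn _ _ _ _ _ _ _ d2 d3); move: len lt; lia.
Qed.

Definition single_arc (p q : T) : rel T := [rel x y | (x == p) && (y == q)].

Lemma comb_fill_chain K D X u a v b y x :
    split_digraph K D -> comb_bipartition K (adj D) ->
    dependency D u a v b -> dependency D y v x u ->
    X = single_arc y x \/ X = single_arc x y ->
  comb_bipartition K (adj (add_arcs D X)).
Proof.
move=> sD cD d1 d2 XE; have [yK vK xK uK] := dep_split sD d2.
have [_ aK _ bK] := dep_split sD d1; have [asymD cK sK] := sD.
have adjE p q : adj (add_arcs D X) p q =
    adj D p q || ((p == x) && (q == y) || (p == y) && (q == x)).
  rewrite /adj /add_arcs; case: XE => -> /=; rewrite /single_arc /=;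
  by case: (D p q); case: (D q p); case: (p == x); case: (p == y);
    case: (q == x); case: (q == y).
have neK p q : p \in K -> q \notin K -> (p == q) = false.
  by move=> pK qK; apply: contraNF qK => /eqP <-.
have yu : y != u.
  by apply: contraNneq (dep_uv d2) => ->; exact: arc_adjr (dep_vb d2).
have xa : x != a.
  by apply: contraTneq (dep_av d2) => ->; exact: asymD _ _ (dep_av d1).
have xv : x != v by rewrite eq_sym; exact: arc_neq asymD (dep_av d2).
(* The vertex [b] of the other dependency serves here: [x] sees [u], hence [b], and [b], [s], [v],
   [x], [k] would be a co-chair. *)
have noleg k s : k \in K -> s \notin K -> adj D k s -> ~~ adj D k y ->
    ~~ adj D s x -> False.
  move=> kK sK' ks nky nsx.
  have sy : s != y by apply: contraNneq nky => <-.
  have su : s != u.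
    by apply: contraNneq nsx => ->; exact: arc_adjr (dep_vb d2).
  have nsv : ~~ adj D s v by rewrite (dep_adj_middles sD cD d2).
  have xb : adj D x b by rewrite -(dep_adj_ends sD cD d1) // arc_adj // (dep_vb d2).
  have kv : k != v by apply: contraNneq nky => ->; exact: arc_adjr (dep_ua d2).
  have kx : k != x by apply: contraNneq nsx => <-; rewrite adjC.
  have nku : ~~ adj D k u by rewrite -(dep_adj_ends sD cD d2).
  have ka : k != a by apply: contraNneq nku => ->; exact: arc_adjr (dep_ua d1).
  have nkb : ~~ adj D k b by rewrite -(dep_adj_ends sD cD d1).
  case: cD => _ cS; have := cS b s v x k bK sK' vK xK kK.
  rewrite eq_sym => /(_ xv); rewrite (arc_adjr (dep_vb d1)) adjC xb.
  rewrite (negPf nsv) (negPf nsx) !(adjC _ _ k) ks (negPf nkb).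
  by move/(_ isT isT isT isT isT).
case: (cD) => cC cS; split.
  apply: (@no_chair_add _ _ (adj D) _ x y u v) => //.
  - by rewrite eq_sym.
  - exact: arc_adjr (dep_ua d2).
  - exact: arc_adj (dep_vb d2).
  - by move=> k kK kx kv; apply: (dep_adj_ends sD cD d2).
  - move=> s sK' sy su; rewrite !(adjC _ _ s); apply/esym.
    exact: (dep_adj_middles sD cD d2).
  - move=> k s kK sK' ks nky; rewrite !(adjC _ _ s); exact: noleg ks nky.
  - by move=> p q pK qK; rewrite adjE (neK p y) // orbF.
apply: (@no_chair_add _ _ (adj D) _ y x v u) => //.
- by rewrite eq_sym.
- exact: arc_adjr (dep_vb d2).
- exact: arc_adj (dep_ua d2).
- move=> s sK' sy su; apply/esym; exact: (dep_adj_middles sD cD d2).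
- by move=> k kK kx kv; rewrite !(adjC _ _ k); apply: (dep_adj_ends sD cD d2).
- move=> s k sK' kK sk nsx; rewrite !(adjC _ _ k) => nyk.
  by apply: noleg nyk nsx; rewrite // adjC.
- by move=> p q pK qK; rewrite adjE (neK q y) // andbF.
Qed.

(** Induction on the number of non-adjacent ordered pairs, which drops whenever a chain is
    filled. *)
Lemma comb_split_SNP K D (x0 : T) :
  split_digraph K D -> comb_bipartition K (adj D) -> exists v, has_SNP D v.
Proof.
pose missing D := [set p : T * T | ~~ adj D p.1 p.2].
move: {2}#|_| (leqnn #|missing D|) => n.
elim: n D => [|n IHn] D len sD cD.
  apply: (unchained_SNP sD cD _ x0) => u a v b y x d _.
  have : (u, v) \in missing D by rewrite inE; exact: dep_uv d.
  by move: len; rewrite leqn0 cards_eq0 => /eqP->; rewrite inE.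
have [|nochain] := boolP [exists u, exists v, source D u v &&
    [exists y, exists x, dep D y v x u]]; last first.
  apply: (unchained_SNP sD cD _ x0) => u a v b y x d1 d2; case/negP: nochain.
  apply/existsP; exists u; apply/existsP; exists v; apply/andP; split.
    by apply/sourceP; exists a, b.
  by apply/existsP; exists y; apply/existsP; exists x; apply/depP.
case/existsP=> u /existsP[v /andP[/sourceP[a [b d1]]]].
case/existsP=> y /existsP[x /depP d2].
have [{d1 d2}u [{}a [{}v [{}b [{}y [{}x [d1 d2 good]]]]]]] := first_chain sD d1 d2.
have [yK vK xK uK] := dep_split sD d2; have nyx := dep_uv d2.
have nxy : ~~ adj D x y by rewrite adjC.
have yx : y != x by apply: contraNneq yK => ->.
have fewer X : X y x || X x y -> #|missing (add_arcs D X)| <= n.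
  move=> Xyx; rewrite -ltnS; apply: leq_trans len; apply/proper_card/properP.
  split; last first.
    by exists (y, x); rewrite !inE // negbK /adj /add_arcs /= orbACA Xyx orbT.
  by apply/subsetP => p; rewrite !inE => /add_arcs_adj.
case/orP: good => [cyx|cxy].
  pose X := single_arc y x.
  have sX : split_digraph K (add_arcs D X).
    apply: split_add_arcs => // p q /andP[/eqP-> /eqP->].
    by rewrite /X /single_arc /= eq_sym (negPf yx) (negPf yK) xK.
  have cX : comb_bipartition K (adj (add_arcs D X)).
    by apply: (comb_fill_chain sD cD d1 d2); left.
  have [|f sf] := IHn _ _ sX cX; first by rewrite fewer // /X /single_arc /= !eqxx.
  exists f; apply: (add_end_to_middle sD _ _ sf) => [p c q r r'|p q].
    exact: dep_uniq_end sD cD _ _ _ _ _.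
  move=> /andP[/eqP-> /eqP->]; rewrite cyx andbT.
  by apply/sourceP; exists v, u.
pose X := single_arc x y.
have sX : split_digraph K (add_arcs D X).
  apply: split_add_arcs => // p q /andP[/eqP-> /eqP->].
  by rewrite /X /single_arc /= (negPf yx) (negPf yK) xK.
have cX : comb_bipartition K (adj (add_arcs D X)).
  by apply: (comb_fill_chain sD cD d1 d2); right.
have [|f sf] := IHn _ _ sX cX; first by rewrite fewer // /X /single_arc /= !eqxx orbT.
exists f; apply: (add_middle_to_end sD _ _ sf) => [p c c' q r|p q].
  exact: dep_uniq_middle sD cD _ _ _ _ _.
move=> /andP[/eqP-> /eqP->]; rewrite cxy andbT.
by apply/sourceP; exists v, u.
Qed.

End Digraph.

(** * Combs are split graphs *)

Section SplitGraphs.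
Variables (T : finType) (e : rel T).
Hypotheses (sym_e : symmetric e) (irr_e : irreflexive e).

Lemma has_induced_seq (n : nat) (h : rel 'I_n) (x0 : T) (s : seq T) :
    size s = n -> uniq s -> symmetric h -> irreflexive h ->
    (forall i j : 'I_n, i < j -> e (nth x0 s i) (nth x0 s j) = h i j) ->
  has_induced h e.
Proof.
move=> szs us sym_h irr_h eE; exists (fun i : 'I_n => nth x0 s i).
  move=> i j /eqP; rewrite nth_uniq ?szs // => /eqP; exact: val_inj.
move=> i j; have [ij|ji|/val_inj->] := ltngtP i j; first exact: eE.
  by rewrite sym_e sym_h eE.
by rewrite irr_e irr_h.
Qed.

Lemma sym_cycle n : symmetric (@cycle_graph n).
Proof. by move=> i j; rewrite /cycle_graph /= orbC. Qed.

Lemma sym_compl (S : finType) (h : rel S) : symmetric h -> symmetric (compl_graph h).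
Proof. by move=> sym_h x y; rewrite /compl_graph /= eq_sym sym_h. Qed.

Lemma irr_compl (S : finType) (h : rel S) : irreflexive (compl_graph h).
Proof. by move=> x; rewrite /compl_graph /= eqxx. Qed.

Lemma sym_chair : symmetric chair.
Proof. by move=> i j; rewrite /chair /= orbC. Qed.

Lemma adj_neq x y : e x y -> x != y.
Proof. by move=> xy; apply: contraTneq xy => ->; rewrite irr_e. Qed.

Lemma sep_neq x y z : e x z -> ~~ e y z -> x != y.
Proof. by move=> xz yz; apply: contraNneq yz => <-. Qed.

Lemma adj_neqC x y : e x y -> y != x.
Proof. by rewrite eq_sym; apply: adj_neq. Qed.

Lemma sep_neqC x y z : e x z -> ~~ e y z -> y != x.
Proof. by rewrite eq_sym; apply: sep_neq. Qed.

Local Ltac edge := first [assumption | by rewrite sym_e].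

(** Vertices are told apart by an edge between them or by a vertex seeing exactly one of them; only
    twins need an explicit hypothesis. *)
Local Ltac distinct :=
  match goal with
  | H : is_true (?x != ?y) |- is_true (?x != ?y) => exact: H
  | H : is_true (e ?x ?y) |- is_true (?x != ?y) => exact: (adj_neq H)
  | H : is_true (e ?y ?x) |- is_true (?x != ?y) => exact: (adj_neqC H)
  | H : is_true (e ?x ?z) |- is_true (?x != ?y) => apply: (sep_neq H); edge
  | H : is_true (e ?y ?z) |- is_true (?x != ?y) => apply: (sep_neqC H); edge
  | H : is_true (e ?z ?x) |- is_true (?x != ?y) =>
      apply: (@sep_neq x y z); edge
  | H : is_true (e ?z ?y) |- is_true (?x != ?y) =>
      apply: (@sep_neqC y x z); edge
  end.

Local Ltac all_distinct :=
  rewrite /= !inE !negb_or; do ?[apply/andP; split]; first [done | distinct].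

Local Ltac all_edges :=
  do 2!case=> [[|[|[|[|[|?]]]]] ?] //=; move=> _;
  match goal with |- e ?x ?y = ?h =>
    first [ have -> : h = true by []; edge
          | have -> : h = false by []; apply/negbTE; edge ] end.

Lemma induced_C4 a b c d :
    e a b -> e b c -> e c d -> e d a -> ~~ e a c -> ~~ e b d ->
    a != c -> b != d ->
  has_induced (@cycle_graph 4) e.
Proof.
move=> ab bc cd da nac nbd ac bd.
apply: (@has_induced_seq 4 _ a [:: a; b; c; d]) => //; first all_distinct.
- exact: sym_cycle.
- by case=> [[|[|[|[|?]]]] ?].
all_edges.
Qed.

Lemma induced_2K2 a b c d :
    e a b -> e c d -> ~~ e a c -> ~~ e a d -> ~~ e b c -> ~~ e b d ->
  has_induced (compl_graph (@cycle_graph 4)) e.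
Proof.
move=> ab cd nac nad nbc nbd.
(* The edges of the complement join opposite vertices of the cycle, hence this order. *)
apply: (@has_induced_seq 4 _ a [:: a; c; b; d]) => //; first all_distinct.
- exact/sym_compl/sym_cycle.
- exact: irr_compl.
all_edges.
Qed.

Lemma induced_C5 a b c d f :
    e a b -> e b c -> e c d -> e d f -> e f a ->
    ~~ e a c -> ~~ e b d -> ~~ e c f -> ~~ e d a -> ~~ e f b ->
  has_induced (@cycle_graph 5) e.
Proof.
move=> ab bc cd df fa nac nbd ncf nda nfb.
apply: (@has_induced_seq 5 _ a [:: a; b; c; d; f]) => //; first all_distinct.
- exact: sym_cycle.
- by case=> [[|[|[|[|[|?]]]]] ?].
all_edges.
Qed.

Lemma induced_chair x y z t v :
    e x y -> e y z -> e z t -> e z v -> t != v ->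
    ~~ e x z -> ~~ e x t -> ~~ e x v -> ~~ e y t -> ~~ e y v -> ~~ e t v ->
  has_induced chair e.
Proof.
move=> xy yz zt zv tv nxz nxt nxv nyt nyv ntv.
apply: (@has_induced_seq 5 _ x [:: x; y; z; t; v]) => //; first all_distinct.
- exact: sym_chair.
- by case=> [[|[|[|[|[|?]]]]] ?].
all_edges.
Qed.

Lemma induced_cochair x y z t v :
    ~~ e x y -> ~~ e y z -> ~~ e z t -> ~~ e z v -> e t v ->
    e x z -> e x t -> e x v -> e y t -> e y v ->
  has_induced cochair e.
Proof.
move=> xy yz zt zv tv nxz nxt nxv nyt nyv.
apply: (@has_induced_seq 5 _ x [:: x; y; z; t; v]) => //; first all_distinct.
- exact/sym_compl/sym_chair.
- exact: irr_compl.
all_edges.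
Qed.

Definition clique (K : {set T}) : bool :=
  [forall x in K, forall y in K, (x != y) ==> e x y].

Lemma cliqueP (K : {set T}) :
  reflect (forall x y, x \in K -> y \in K -> x != y -> e x y) (clique K).
Proof.
apply: (iffP forall_inP) => [cK x y xK yK|cK x xK].
  by have /forall_inP/(_ y yK)/implyP := cK x xK.
by apply/forall_inP => y yK; apply/implyP; exact: cK.
Qed.

Lemma clique_add (K : {set T}) x :
  clique K -> (forall y, y \in K -> y != x -> e x y) -> clique (x |: K).
Proof.
move=> /cliqueP cK cx; apply/cliqueP => y z; rewrite !inE.
case/predU1P=> [->|yK]; case/predU1P=> [->|zK]; rewrite ?eqxx // => yz.
- by apply: cx; rewrite // eq_sym.
- by rewrite sym_e; apply: cx.
- exact: cK.
Qed.

(* A clique maximizing first its size and then its degree sum; the summand #|T|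
   makes larger cliques heavier. *)
Lemma comb_split : comb e ->
  exists K : {set T}, (forall x y, x \in K -> y \in K -> x != y -> e x y) /\
    (forall x y, x \notin K -> y \notin K -> ~~ e x y).
Proof.
move=> [noC4 no2K2 noC5 _ _].
pose deg x := #|[set z | e x z]|.
pose weight (K : {set T}) := \sum_(x in K) (deg x + #|T|).
have c0 : clique set0 by apply/cliqueP => x y; rewrite inE.
case: (arg_maxnP weight c0) => K clK maxK; have cK := cliqueP _ clK.
exists K; split=> // x0 y0 x0K y0K; apply/negP => xy0.
have weightU p (A : {set T}) : p \notin A ->
    weight (p |: A) = deg p + #|T| + weight A.
  by move=> pA; rewrite /weight big_setU1.
have degT x : deg x <= #|T| by apply: max_card.
have main x y : x \notin K -> y \notin K -> e x y ->
    (forall z, z \in K -> ~~ e x z -> ~~ e y z) -> False.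
  move=> xK yK xy sub.
  have deg_x : 0 < deg x by apply/card_gt0P; exists y; rewrite inE.
  have [z zK nxz] : exists2 z, z \in K & ~~ e x z.
    apply/exists_inP; rewrite -negb_forall_in; apply/negP => /forall_inP all_x.
    have := maxK (x |: K); rewrite clique_add // => [/(_ isT)|y' /all_x //].
    by rewrite weightU //; move: deg_x; move: (deg x) (weight _) #|T|; clear; lia.
  have uniq_z z' : z' \in K -> z' != z -> e x z'.
    move=> zK' zz'; apply/negPn/negP => nxz'; apply: no2K2.
    by apply: (@induced_2K2 x y z z'); rewrite ?sub // cK // eq_sym.
  have nyz := sub z zK nxz.
  have subK : clique (K :\ z).
    by apply/cliqueP => p q /setD1P[_ pK] /setD1P[_ qK]; exact: cK.
  have clx : clique (x |: K :\ z).
    by apply: clique_add => // p /setD1P[pz pK] _; exact: uniq_z.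
  have wK : weight K = deg z + #|T| + weight (K :\ z).
    by rewrite /weight (big_setD1 z zK).
  (* Otherwise exchanging [z] for both [x] and [y] would give a larger clique. *)
  have [w wK' ] : exists2 w, w \in K & ~~ ((w != z) ==> e y w).
    apply/exists_inP; rewrite -negb_forall_in; apply/negP => /forall_inP all_y.
    have clxy : clique (y |: (x |: K :\ z)).
      apply: clique_add => // p; rewrite !inE => /predU1P[->|/andP[pz pK]] _.
        by rewrite sym_e.
      by have /implyP := all_y p pK; apply.
    have := maxK _ clxy; rewrite wK weightU; last first.
      by rewrite !inE negb_or negb_and yK orbT andbT eq_sym adj_neq.
    rewrite weightU; last by rewrite !inE negb_and xK orbT.
    move: deg_x (degT z); move: (weight _) (deg x) (deg y) (deg z) #|T|.
    by clear; lia.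
  rewrite negb_imply => /andP[wz nyw]; have xw := uniq_z w wK' wz.
  have deg_le : deg x <= deg z.
    have := maxK _ clx; rewrite wK weightU; last first.
      by rewrite !inE negb_and xK orbT.
    by move: (weight _) (deg x) (deg z) #|T|; clear; lia.
  (* The neighbour [y] of [x] is missed by [z], so [deg x <= deg z] forces a neighbour of [z] missed
     by [x]. *)
  have [t zt nxt] : exists2 t, e z t & ~~ e x t.
    apply/exists_inP; rewrite -negb_forall_in; apply/negP => /forall_inP all_t.
    move: deg_le; rewrite leqNgt => /negP; apply; apply/proper_card/properP.
    split; first by apply/subsetP => t; rewrite !inE => /all_t.
    by exists y; rewrite inE // sym_e.
  have [yt|nyt] := boolP (e y t); last first.
    by apply: no2K2; apply: (@induced_2K2 x y z t).
  have wNy : w != y by apply: contraNneq yK => <-.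
  have zw : e z w by rewrite cK // eq_sym.
  have [wt|nwt] := boolP (e w t).
    have xNt : x != t by apply: contraNneq nxz => ->; rewrite sym_e.
    by apply: noC4; apply: (@induced_C4 w x y t); rewrite // sym_e.
  by apply: noC5; apply: (@induced_C5 x y t z w); rewrite // sym_e.
(* The non-neighbours of [x0] and [y0] in [K] are nested, since otherwise an induced [C_4] appears;
   so [main] applies in one order or the other. *)
have [/forall_inP sub|] := boolP [forall z in K, ~~ e x0 z ==> ~~ e y0 z].
  by apply: (main x0 y0) => // z zK; apply/implyP/sub.
rewrite negb_forall_in => /exists_inP[z zK]; rewrite negb_imply negbK.
move=> /andP[nxz yz].
apply: (main y0 x0) => //; first by rewrite sym_e.
move=> w wK nyw; apply/negP => xw.
apply: noC4; apply: (@induced_C4 x0 y0 z w) => //.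
- by rewrite cK //; apply: contraTneq yz => ->.
- by rewrite sym_e.
- by apply: contraNneq x0K => ->.
- by apply: contraNneq y0K => ->.
Qed.

Lemma comb_no_chair (K : {set T}) :
    comb e -> (forall x y, x \in K -> y \in K -> x != y -> e x y) ->
    (forall x y, x \notin K -> y \notin K -> ~~ e x y) ->
  comb_bipartition K e.
Proof.
move=> [_ _ _ nochair nocochair] cK sK; split.
  move=> k k' t1 t2 t kK kK' t1K t2K tK t12 k1 k2 nk1 nk2 kt.
  apply/negPn/negP => nkt; apply: nochair.
  have kk' : e k' k by apply: cK => //; apply: contraNneq nkt => <-.
  by apply: (@induced_chair t k' k t1 t2) => //;
    first [exact: sK | rewrite sym_e].
move=> s s' c1 c2 c sK1 sK2 c1K c2K cK' c12 s1 s2 ns1 ns2 sc.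
apply/negPn/negP => nsc; apply: nocochair.
have cc1 : e c c1 by apply: cK => //; apply: contraNneq ns1 => <-.
have cc2 : e c c2 by apply: cK => //; apply: contraNneq ns2 => <-.
by apply: (@induced_cochair c s s' c1 c2) => //;
  first [exact: sK | exact: cK | rewrite sym_e].
Qed.

End SplitGraphs.

Theorem corollary6 (T : finType) (e D : rel T) :
  simple_graph e -> comb e -> 0 < #|T| -> orientation e D ->
  exists v : T, #|out_nbrs D v| <= #|second_out_nbrs D v|.
Proof.
move=> [sym_e irr_e] comb_e /card_gt0P[x0 _] [eE asymD].
have [K [cK sK]] := comb_split sym_e irr_e comb_e.
have [A B] := comb_no_chair sym_e irr_e comb_e cK sK.
have adjE x y : adj D x y = e x y by rewrite eE.
apply: (@comb_split_SNP _ K D x0).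
  split=> [x y xy|x y|x y]; rewrite ?adjE; [|exact: cK|exact: sK].
  by have := asymD x y; rewrite xy.
by split=> p p' q1 q2 q; rewrite !adjE; [exact: A|exact: B].
Qed.
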